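(* Let $\Delta_1 = \{\Delta_t^{\bar x} : \bar x \in X^{t^c}, t \in \mathbb{Z}^d\}$ be a one-point transition energy field satisfying the following two conditions. (i) For any $\Lambda \in W$, any distinct $t,s \in \Lambda$ and any $I \subset \Lambda \setminus \{t,s\}$, $$\Delta_t^{zy}(x, \theta_t) - \Delta_t^{zv}(x, \theta_t) = \Delta_t^y(x, \theta_t) - \Delta_t^v(x, \theta_t), \qquad x \in X^t,\ y,v \in X^s,\ z \in X^I .$$ (ii) $C_1(1+C_2)<1$, where $$C_1 = \frac{e^{\| \Delta_1 \|} N_X}{1 + e^{\| \Delta_1 \|} N_X}, \qquad C_2 = 2 \big( 1 + 2 e^{\| \Delta_1 \|} N_X \big) \big(\exp \{e^D -1\} -1 \big), \qquad N_X = | X | - 1 .$$ Then the equation $$\rho = \delta + \mathscr{K} \rho$$ has a unique solution $\rho$ in the Banach space $\mathscr{B}_*$, and it is given by $$\rho = ( 1- \mathscr{K} )^{-1} \delta = \left( 1 + \sum_{n=1}^\infty \mathscr{K}^n \right) \delta .$$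
   Context: **Lattice and configurations.** $\mathbb{Z}^d$, $d\ge 1$, is the integer lattice. For $S\subset\mathbb{Z}^d$, $W(S)$ is the set of all nonempty finite subsets of $S$, and $W=W(\mathbb{Z}^d)$. $S^c$ is the complement of $S$ in $\mathbb{Z}^d$. Braces are omitted for one-point sets ($t^c=\{t\}^c$, $I\setminus t = I \setminus\{t\}$, $t\cup J=\{t\}\cup J$). $X$ is a finite set with $1<|X|<\infty$, and each $X^t$, $t\in\mathbb{Z}^d$, is a copy of $X$. For $S\subset\mathbb{Z}^d$, $X^S$ is the set of configurations $x=(x_t,t\in S)$, $x_t\in X^t$; $X^{\emptyset}$ consists of the single empty configuration. For disjoint $S,T$ and $x\in X^S$, $y\in X^T$, the concatenation $xy\in X^{S\cup T}$ equals $x$ on $S$ and $y$ on $T$. $x_T$ is the restriction of $x$ to $T$. A fixed element $\theta_t\in X^t$ (vacuum) is chosen for each $t$; $\theta=(\theta_t,t\in\mathbb{Z}^d)$ and $\theta_S$ is its restriction to $S$. $X_*^t=X^t\setminus\{\theta_t\}$, and $X_*^S$ is the set of configurations on $S$ none of whose components is the vacuum. $L_*=\bigcup_{J\in W}X_*^J$. **One-point transition energy field.** A set $\Delta_1=\{\Delta_t^{\bar x}:\bar x\in X^{t^c},t\in\mathbb{Z}^d\}$ of real functions $\Delta_t^{\bar x}(x,u)$, $x,u\in X^t$, such that for all $t$ and $\bar x\in X^{t^c}$ $$\Delta_t^{\bar x}(x,u)=\Delta_t^{\bar x}(x,y)+\Delta_t^{\bar x}(y,u),\qquad x,u,y\in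 X^t,$$ and for all distinct $t,s\in\mathbb{Z}^d$ and $\bar x\in X^{\{t,s\}^c}$ $$\Delta_t^{\bar x y}(x,u)+\Delta_s^{\bar x u}(y,v)=\Delta_s^{\bar x x}(y,v)+\Delta_t^{\bar x v}(x,u),\qquad x,u\in X^t,\ y,v\in X^s.$$ **Vacuum boundary notation.** For $t\in\mathbb{Z}^d$, finite $I\subset t^c$ and $z\in X^I$, $\Delta_t^z$ stands for $\Delta_t^{z\theta_{(t\cup I)^c}}$; when $I=\emptyset$ this is $\Delta_t=\Delta_t^{\theta_{t^c}}$. **Norms.** $$\|\Delta_1\|=\sup_{t\in\mathbb{Z}^d}\ \sup_{x,u\in X^t}\ \sup_{\bar x\in X^{t^c}}|\Delta_t^{\bar x}(x,u)|,\qquad D=\sup_{t\in\mathbb{Z}^d}\ \sup_{x\in X^t}\ \sum_{s\in t^c}\ \sup_{y\in X^s}|\Delta_s^x(y,\theta_s)-\Delta_s(y,\theta_s)|.$$ The condition $C_1(1+C_2)<1$ is understood to include that $\|\Delta_1\|$ and $D$ are finite. **Banach space.** $\mathscr{B}_*$ is the Banach space of real functions $\varphi$ on $L_*$ that are bounded in the norm $\|\varphi\|=\sup_{\Lambda\in W}\|\varphi\|_\Lambda<\infty$, where $\|\varphi\|_\Lambda=\sum_{x\in X_*^\Lambda}|\varphi(x)|$. **Operator $\mathscr{K}$ and function $\delta$.** $\mathbb{Z}^d$ is endowed with a fixed total order (e.g. lexicographic). For $I\in W$ let $t$ denote the smallest element of $I$, $I'=I\setminus t$, and for $x\in X_*^I$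 let $x'=x_{I'}$. The operator $\mathscr{K}=\mathscr{K}^{\Delta_1}$ on $\mathscr{B}_*$ is $$(\mathscr{K}\varphi)(x)=\gamma(x)\big((S\varphi)(x)+(T\varphi)(x)\big),\qquad x\in X_*^I,\ I\in W,$$ where $$\gamma(x)=\frac{e^{\Delta_t^{x'}(x_t,\theta_t)}}{\sum_{\alpha\in X^t}e^{\Delta_t^{x'}(\alpha,\theta_t)}},\qquad (S\varphi)(x)=\varphi(x')\ \text{if }|I|>1,\quad (S\varphi)(x)=0\ \text{if }|I|=1,$$ $$(T\varphi)(x)=(G\varphi)(x)+\sum_{\alpha\in X_*^t}e^{\Delta_t^{x'}(\alpha,\theta_t)}\Big((G\varphi)(x)-(G\varphi)(\alpha x')\Big),$$ $$(G\varphi)(x)=\sum_{J\in W(I^c)}\ \sum_{y\in X_*^J}K_{t\cup J}(x_ty)\Big(\varphi(x'y)-\sum_{\alpha\in X_*^t}\varphi(\alpha x'y)\Big),$$ $$K_{t\cup J}(x_ty)=\prod_{s\in J}\left(e^{\Delta_s^{x_t}(y_s,\theta_s)-\Delta_s(y_s,\theta_s)}-1\right).$$ The function $\delta$ on $L_*$ is $\delta(x)=\gamma(x)$ if $|I|=1$ and $\delta(x)=0$ if $|I|>1$, for $x\in X_*^I$, $I\in W$. *)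

(* Defs.v *)
From HB Require Import structures.
From mathcomp Require Import all_boot all_order all_algebra finmap.
From mathcomp Require Import all_classical all_reals all_analysis.

Set Implicit Arguments.
Unset Strict Implicit.
Unset Printing Implicit Defensive.
Import Order.TTheory GRing.Theory Num.Theory.
Import numFieldNormedType.Exports.

Local Open Scope classical_set_scope.
Local Open Scope fset_scope.
Local Open Scope fmap_scope.
Local Open Scope ring_scope.

Notation lattice d := 'rV[int]_d.

(** [config X S] is X^S for an arbitrary S; a configuration on a finite set I
    is also represented by a finite map whose domain [domf] is I. *)
Definition config (d : nat) (X : Type) (S : set (lattice d)) : Type :=
  set_type S -> X.
Notation fconfig d X := {fmap lattice d -> X}.

(** The concatenation of [xbar] and the one-point configuration y, when T is S
    together with one more site. *)
Definition extend (d : nat) (X : Type) (S T : set (lattice d))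
    (xbar : config X S) (y : X) : config X T :=
  fun r => oapp xbar y (insub (val r)).

Section Field.
Variables (R : realType) (d : nat) (X : finType) (theta : lattice d -> X).

Definition energy_field : Type :=
  forall t : lattice d, config X (~` [set t]) -> X -> X -> R.

Definition transition_energy_field (Delta : energy_field) : Prop :=
  (forall t xbar (x u y : X),
     Delta t xbar x u = Delta t xbar x y + Delta t xbar y u) /\
  (forall (t s : lattice d) (xbar : config X (~` [set t; s])) (x u y v : X),
     t != s ->
     Delta t (extend xbar y) x u + Delta s (extend xbar u) y v =
     Delta s (extend xbar x) y v + Delta t (extend xbar v) x u).

(** The boundary condition z theta_{(t U I)^c} outside t, where I = [domf z]
    is meant not to contain t. *)
Definition vac (t : lattice d) (z : fconfig d X) : config X (~` [set t]) :=
  fun r => odflt (theta (val r)) z.[? val r].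
Arguments vac : clear implicits.

Definition esup (T : Type) (f : T -> \bar R) : \bar R := ereal_sup (range f).

Definition tef_norm (Delta : energy_field) : \bar R :=
  esup (fun t => esup (fun x => esup (fun u => esup (fun xbar =>
    `|Delta t xbar x u|%:E)))).

Definition tef_D (Delta : energy_field) : \bar R :=
  esup (fun t => esup (fun x : X =>
    \esum_(s in [set~ t]) esup (fun y : X =>
      `|Delta s (vac s [fmap].[t <- x]) y (theta s)
        - Delta s (vac s [fmap]) y (theta s)|%:E))).

Definition vacuum_increment_condition (Delta : energy_field) : Prop :=
  forall (L : {fset lattice d}) (t s : lattice d) (I : {fset lattice d}),
    t \in L -> s \in L -> t != s -> I `<=` L `\` [fset t; s] ->
  forall (x y v : X) (z : fconfig d X), domf z = I ->
    Delta t (vac t z.[s <- y]) x (theta t)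
      - Delta t (vac t z.[s <- v]) x (theta t) =
    Delta t (vac t [fmap].[s <- y]) x (theta t)
      - Delta t (vac t [fmap].[s <- v]) x (theta t).

Definition const_N : R := #|X|%:R - 1.

(** [fine] is meaningful below when [tef_norm Delta] and [tef_D Delta] are
    finite, to be assumed separately. *)
Definition const_C1 (Delta : energy_field) : R :=
  expR (fine (tef_norm Delta)) * const_N /
  (1 + expR (fine (tef_norm Delta)) * const_N).

Definition const_C2 (Delta : energy_field) : R :=
  2 * (1 + 2 * (expR (fine (tef_norm Delta)) * const_N))
    * (expR (expR (fine (tef_D Delta)) - 1) - 1).

End Field.
Arguments vac {d X} theta t z.

Section Lstar.
Variables (d : nat) (X : finType) (theta : lattice d -> X).

Definition starred (x : fconfig d X) : bool :=
  (domf x != fset0) && [forall s : domf x, x s != theta (val s)].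

Definition Lstar : Type := {x : fconfig d X | starred x}.

HB.instance Definition _ := Choice.on Lstar.
HB.instance Definition _ := SubType.on Lstar.

(** X_*^L, for L nonempty *)
Definition Xstar (L : {fset lattice d}) : set Lstar :=
  [set x | domf (val x) = L].

Lemma finite_Xstar L : finite_set (Xstar L).
Proof.
have fin : finite_set [set x : fconfig d X | domf x = L].
  apply: (@sub_finite_set _ _ (range (fun f : {ffun L -> X} => FinMap f))).
    by move=> [A f] /= AL; case: _ / AL; exists f.
  exact/finite_image/finite_finset.
apply: (@sub_finite_set _ _ (val @^-1` [set x : fconfig d X | domf x = L])).
  by [].
by apply: finite_preimage => // x y _ _; exact: val_inj.
Qed.

End Lstar.
Arguments Xstar {d X} theta L.

Section Bstar.
Variables (R : realType) (d : nat) (X : finType) (theta : lattice d -> X).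
Local Notation Lstar := (Lstar theta).
Implicit Types (f g : Lstar -> R) (L : {fset lattice d}).

Definition normL L f : R := \sum_(x \in Xstar theta L) `|f x|.

Definition normsL f : set R := [set normL L f | L in [set L | L != fset0]].

Definition Bstar_pred : {pred (Lstar -> R)} := mem [set f | has_ubound (normsL f)].

Definition Bstar : Type := {f : Lstar -> R | f \in Bstar_pred}.
HB.instance Definition _ := SubType.on Bstar.
HB.instance Definition _ := Choice.on Bstar.

Lemma normLE L f : normL L f = \sum_(x <- fset_set (Xstar theta L)) `|f x|.
Proof. by rewrite /normL fsbig_finite//; exact: finite_Xstar. Qed.

Lemma normLD L f g : normL L (f + g) <= normL L f + normL L g.
Proof.
by rewrite !normLE -big_split; apply: ler_sum => x _; exact: ler_normD.
Qed.

Lemma normLZ L (a : R) f : normL L (a *: f) = `|a| * normL L f.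
Proof.
rewrite /normL mulr_fsumr; apply: eq_fsbigr => x _.
by rewrite [(a *: f) x]/(a * f x) normrM.
Qed.

Lemma normL_ge0 L f : 0 <= normL L f.
Proof. by apply: fsumr_ge0 => x _. Qed.

Lemma normL_ge (x : Lstar) f : `|f x| <= normL (domf (val x)) f.
Proof.
rewrite /normL (fsbigD1 x)//=; last exact: finite_Xstar.
by rewrite lerDl; apply: fsumr_ge0.
Qed.

Lemma Lstar_neq0 (x : Lstar) : domf (val x) != fset0.
Proof. by have /andP[] := valP x. Qed.

Lemma normsLP M f : ubound (normsL f) M <->
  forall L, L != fset0 -> normL L f <= M.
Proof.
split=> [h L L0|h _ [L /= L0 <-]]; last exact: h.
by apply: h; exists L.
Qed.

Lemma normsL_nonempty f : normsL f !=set0.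
Proof.
exists (normL [fset 0] f), [fset 0] => //=.
by apply/fset0Pn; exists 0; rewrite inE.
Qed.

Lemma Bstar_predP f : f \in Bstar_pred <->
  exists M, forall L, L != fset0 -> normL L f <= M.
Proof.
by rewrite inE; split=> -[M /normsLP h]; exists M.
Qed.

Lemma Bstar_submod_closed : submod_closed Bstar_pred.
Proof.
split=> [|a f g].
  apply/Bstar_predP; exists 0 => L _.
  by rewrite -(scale0r (0 : Lstar -> R)) normLZ normr0 mul0r.
move=> /Bstar_predP[M hM] /Bstar_predP[N hN]; apply/Bstar_predP.
exists (`|a| * M + N) => L L0; apply: (le_trans (normLD _ _ _)).
by rewrite normLZ lerD ?ler_wpM2l ?hM ?hN.
Qed.

HB.instance Definition _ := GRing.isSubmodClosed.Build R (Lstar -> R) Bstar_pred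
  Bstar_submod_closed.
HB.instance Definition _ := [SubChoice_isSubLmodule of Bstar by <:].

Definition normB (phi : Bstar) : R := sup (normsL (val phi)).

Lemma normL_le (phi : Bstar) L : L != fset0 -> normL L (val phi) <= normB phi.
Proof.
move=> L0; apply: ub_le_sup; last by exists L.
by have := valP phi; rewrite inE.
Qed.

Lemma normB_le (phi : Bstar) M :
  (forall L, L != fset0 -> normL L (val phi) <= M) -> normB phi <= M.
Proof.
by move=> /normsLP h; apply: ge_sup => //; exact: normsL_nonempty.
Qed.

Lemma val_le_normB (phi : Bstar) x : `|val phi x| <= normB phi.
Proof. exact/(le_trans (normL_ge _ _))/normL_le/Lstar_neq0. Qed.

Lemma normB_ge0 (phi : Bstar) : 0 <= normB phi.
Proof.
have [_ [L L0 _]] := normsL_nonempty (val phi).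
exact/(le_trans (normL_ge0 L (val phi)))/normL_le.
Qed.

Lemma normBD (phi psi : Bstar) : normB (phi + psi) <= normB phi + normB psi.
Proof.
apply: normB_le => L L0; apply: (le_trans (normLD _ _ _)).
by rewrite lerD ?normL_le.
Qed.

Lemma normBZ (a : R) (phi : Bstar) : normB (a *: phi) = `|a| * normB phi.
Proof.
have le1 (b : R) (psi : Bstar) : normB (b *: psi) <= `|b| * normB psi.
  by apply: normB_le => L L0; rewrite normLZ ler_wpM2l ?normL_le.
apply/eqP; rewrite eq_le le1 /=; have [->|a0] := eqVneq a 0.
  by rewrite normr0 mul0r normB_ge0.
rewrite -ler_pdivlMl ?normr_gt0// -normfV.
by rewrite -{1}(scale1r phi) -(mulVf a0) -scalerA le1.
Qed.

Lemma normB0_eq0 (phi : Bstar) : normB phi = 0 -> phi = 0.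
Proof.
move=> phi0; apply/val_inj/funext => x; apply/eqP.
by rewrite -normr_le0 -phi0 val_le_normB.
Qed.

HB.instance Definition _ := Lmodule_isNormed.Build R Bstar
  normBD normBZ normB0_eq0.

Lemma Bstar_normE (phi : Bstar) : `|phi| = normB phi.
Proof. by []. Qed.

Lemma Bstar_ball (phi psi : Bstar) e : ball phi e psi -> normB (phi - psi) < e.
Proof. by []. Qed.

Lemma Bstar_valB (phi psi : Bstar) : val (phi - psi) = val phi - val psi.
Proof. by []. Qed.

Lemma Bstar_complete (F : set_system Bstar) :
  ProperFilter F -> cauchy F -> cvg F.
Proof.
move=> FF /cauchyP Fc.
pose ev (x : Lstar) (phi : Bstar) : R := val phi x.
have ev_cvg x : cvg (ev x @ F).
  apply: R_complete; apply/cauchy_exP => e /Fc[phi Fphi]; exists (ev x phi).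
  apply: (@filterS _ F _ _ _ _ Fphi) => psi /Bstar_ball /(le_lt_trans _); apply.
  exact: (val_le_normB (phi - psi) x).
pose lim_ev : Lstar -> R := fun x => lim (ev x @ F).
have le_lim (phi : Bstar) e : F (ball phi e) ->
    forall L, L != fset0 -> normL L (val phi - lim_ev) <= e.
  move=> Fphi L L0.
  have : normL L (val phi - val psi) @[psi --> F] --> normL L (val phi - lim_ev).
    rewrite normLE; under eq_cvg do rewrite normLE.
    apply: cvg_big => [|x _]; first exact: add_continuous.
    apply: cvg_norm; apply: cvgB; first exact: cvg_cst.
    exact: ev_cvg.
  move=> /cvgr_to_le; apply; apply: (@filterS _ F _ _ _ _ Fphi) => psi.
  move=> /Bstar_ball /ltW; apply: le_trans.
  exact: (normL_le (phi - psi) L0).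
have lim_in : lim_ev \in Bstar_pred.
  have [phi /le_lim h] := Fc 1 ltr01.
  rewrite -[lim_ev](subKr (val phi)) rpredB ?(valP phi)//.
  by apply/Bstar_predP; exists 1.
apply/cvg_ex; exists (exist _ lim_ev lim_in : Bstar).
apply/cvgrPdist_le => e e0; have [phi Fphi] := Fc _ (divr_gt0 e0 (ltr0Sn R 1)).
near=> psi; rewrite distrC.
have -> : psi - (exist _ lim_ev lim_in : Bstar) =
  (phi - (exist _ lim_ev lim_in : Bstar)) - (phi - psi).
  by rewrite opprB [RHS]addrC addrA subrK.
rewrite (splitr e) (le_trans (ler_normB _ _))// lerD//.
  rewrite Bstar_normE; apply: normB_le => L L0; exact: (le_lim phi).
by apply/ltW; near: psi; apply: (@filterS _ F _ _ _ _ Fphi) => psi /Bstar_ball.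
Unshelve. all: by end_near. Qed.

HB.instance Definition _ := Uniform_isComplete.Build Bstar Bstar_complete.

End Bstar.
Arguments Bstar R {d X} theta.

Definition bstar_fun (R : realType) (d : nat) (X : finType)
  (theta : lattice d -> X) (phi : Bstar R theta) : Lstar theta -> R := val phi.
Coercion bstar_fun : Bstar >-> Funclass.

(** The sum of an absolutely summable family of reals; a junk value otherwise. *)
Definition rsum (R : realType) (T : choiceType) (D : set T) (f : T -> R) : R :=
  fine (\esum_(i in D) ((EFin \o f)^\+)%E i)
  - fine (\esum_(i in D) ((EFin \o f)^\-)%E i).

Section Operator.
Variables (R : realType) (d : nat) (X : finType) (theta : lattice d -> X).
Variables (Delta : energy_field R d X) (le : rel (lattice d)).
Implicit Types (phi : Lstar theta -> R) (x y : fconfig d X).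

(** Values at configurations outside L_* are never used: every occurrence below
    is at a nonempty configuration without vacuum components. *)
Definition ev phi x : R := oapp phi 0 (insub x).

(** The smallest site of the (nonempty) domain of x *)
Definition site x : lattice d := head 0 (sort le (domf x)).
Definition spin x : X := odflt (theta (site x)) x.[? site x]%fmap.
Definition rest x : fconfig d X := x.[~ site x]%fmap.

(** The Boltzmann factor exp (Delta_t^{x'} (a, theta_t)) *)
Definition weight x (a : X) : R :=
  expR (Delta (vac theta (site x) (rest x)) a (theta (site x))).

Definition gammaf x : R := weight x (spin x) / \sum_(a : X) weight x a.

Definition Sop phi x : R :=
  if (1 < #|` domf x|)%N then ev phi (rest x) else 0.

(** K_{t U J} (a y) for a in X^t and y in X^J *)
Definition kernelK (t : lattice d) (a : X) y : R :=
  \prod_(s : domf y)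
    (expR (Delta (vac theta (val s) [fmap].[t <- a]%fmap) (y s) (theta (val s))
           - Delta (vac theta (val s) [fmap]%fmap) (y s) (theta (val s))) - 1).

Definition Gdom x : set {fset lattice d} :=
  [set J | J != fset0 /\ [disjoint J & domf x]%fset].

Definition Gterm phi x (J : {fset lattice d}) : R :=
  \sum_(y \in Xstar theta J)
    kernelK (site x) (spin x) (val y) *
    (ev phi (rest x + val y)%fset
     - \sum_(a : X | a != theta (site x))
         ev phi (rest x + val y)%fset.[site x <- a]%fmap).

Definition Gop phi x : R := rsum (Gdom x) (Gterm phi x).

Definition Top phi x : R :=
  Gop phi x +
  \sum_(a : X | a != theta (site x))
    weight x a * (Gop phi x - Gop phi (rest x).[site x <- a]%fmap).

Definition Kop phi : Lstar theta -> R :=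
  fun u => gammaf (val u) * (Sop phi (val u) + Top phi (val u)).

Definition deltaf : Lstar theta -> R :=
  fun u => if #|` domf (val u)| == 1%N then gammaf (val u) else 0.

End Operator.

(* Main.v *)
Require Import Defs.
From HB Require Import structures.
From mathcomp Require Import all_boot all_order all_algebra finmap.
From mathcomp Require Import all_classical all_reals all_analysis.
From mathcomp Require Import ring lra.
Import Order.TTheory GRing.Theory Num.Theory.
Import numFieldNormedType.Exports.
Local Open Scope classical_set_scope.
Local Open Scope ring_scope.
Set Implicit Arguments.
Unset Strict Implicit.
Unset Printing Implicit Defensive.

(** The operator K is a contraction of B_* with constant q = C_1 (1 + C_2), so
    1 - K is inverted by its Neumann series ([neumann]) and everything else
    follows formally.  The whole content is the norm estimate [normL_Kop_le].

    Fix the support I, let t be its smallest site, and write a configuration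
    without vacuum components on I as a x', with a the spin at t and x' its
    restriction to I minus t.  Two estimates give the constant.

    - The nonlocal part G.  The kernel K_{t U J}(a y) is at most the product over
      s in J of exp (d_s) - 1, where d_s is the influence at s of the spin a at
      t, and the d_s sum to at most D.  Summing |G phi (a x')| over x' with a
      fixed, the pairs (x', y) run through the configurations on (I minus t) U J
      and the triples (alpha, x', y) through those on I U J, so each J costs
      2 |phi| times that product.  Expanding a product of factors 1 + k_s over
      the subsets J bounds the sum over J by exp (sum k_s) - 1, hence by
      exp (exp D - 1) - 1 ([esum_activity_le], [sum_Gop_le]).
      It matters that a stays fixed while x' and J are summed: D is a supremum
      over the spin a of a sum over sites, not a sum of suprema.

    - The term S and the sum over the spin at t.  Put
      w_a = exp (Delta_t^{x'} (a, theta_t)) and W = sum_{a <> theta_t} w_a, so that gamma (a x') = w_a / (1 + W).  Since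
      w_a <= e^||Delta|| and u / (1 + u) increases, the sum of gamma over a is
      at most C_1, which controls the term S; and the terms
      gamma (a x') |T phi (a x')| sum to at most
      sum_a w_a |G phi (a x')| (1 + 2 W) / (1 + W) ([one_site_bound]).
      Summed over x', the |X| - 1 values of a each contribute at most
      e^||Delta|| (1 + 2 e^||Delta|| N_X) / (1 + e^||Delta|| N_X) times the bound
      on G, that is C_1 C_2 |phi| in all.

    The same bound on the nonlocal part shows that the series defining G is
    absolutely summable, and summability is what makes G, hence K, linear. *)

(** * Neumann series of a contraction *)

(** Packages a map that is shown to be linear only inside a proof, such as a
    pointwise limit. *)
Lemma linear_function (R : pzRingType) (U V : lmodType R) (f : U -> V) :
  linear f -> exists g : {linear U -> V}, g =1 f.
Proof.
move=> lf; pose gL := GRing.isLinear.Build R U V *:%R f lf.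
pose g : {linear U -> V} := HB.pack f gL.
by exists g.
Qed.

Section Neumann.
Variables (R : realType) (V : completeNormedModType R) (K : {linear V -> V}).
Variable q : R.
Hypotheses (q0 : 0 <= q) (q1 : q < 1) (Kq : forall v, `|K v| <= q * `|v|).

Lemma norm_iter_le n v : `|iter n K v| <= q ^+ n * `|v|.
Proof.
elim: n => [|n ih]; first by rewrite expr0 mul1r.
by rewrite iterS (le_trans (Kq _))// exprS -mulrA ler_wpM2l.
Qed.

Lemma iter_linear n : linear (fun v => iter n K v).
Proof. by move=> a u v; elim: n => //= n ->; rewrite linearP. Qed.

Let S v := series (fun n => iter n K v).

Lemma is_cvg_neumann v : cvgn (S v).
Proof.
apply: normed_cvg.
apply: (@series_le_cvg _ _ (geometric `|v| q)) => [n|n|n|].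
- exact: normr_ge0.
- exact: geometric_ge0.
- by rewrite /= mulrC norm_iter_le.
- by apply: is_cvg_geometric_series; rewrite ger0_norm.
Qed.

Lemma cvg_iter0 v : iter n K v @[n --> \oo] --> (0 : V).
Proof. exact/cvg_series_cvg_0/is_cvg_neumann. Qed.

Lemma neumann_partial_le n v : `|S v n| <= (1 - q)^-1 * `|v|.
Proof.
rewrite /S /series /= (le_trans (ler_norm_sum _ _ _))//.
rewrite (@le_trans _ _ (\sum_(0 <= i < n) q ^+ i * `|v|))//.
  by apply: ler_sum => i _; exact: norm_iter_le.
rewrite -mulr_suml ler_wpM2r//.
have q1' : 0 < 1 - q by rewrite subr_gt0.
rewrite -[leRHS]mul1r ler_pdivlMr// mulrC big_mkord.
by rewrite -opprB mulNr -subrX1 opprB gerBl exprn_ge0.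
Qed.

Lemma neumann_telescope n v : S v n - K (S v n) = v - iter n K v.
Proof.
rewrite /S /series /=; elim: n => [|n ih].
  by rewrite big_geq// linear0 !subrr.
rewrite big_nat_recr//= linearD/= opprD addrACA ih.
by rewrite addrA subrK.
Qed.

(** For the partial sums S_N, both (1 - K) S_N v and S_N (1 - K) v telescope to
    v - K^N v, and K^N v tends to 0; so their limit L inverts 1 - K on both
    sides.  Then S_N v - L v = - K^N (L v), whose norm is at most
    q^N / (1 - q) |v|: the convergence is uniform on bounded sets. *)
Lemma neumann :
  continuous K /\
  exists L : {linear V -> V},
    [/\ continuous L,
        cancel (fun v => v - K v) L,
        cancel L (fun v => v - K v),
        (forall e : R, 0 < e -> \forall N \near \oo, forall v,
           `|\sum_(0 <= n < N) iter n K v - L v| <= e * `|v|) &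
        forall v, \sum_(0 <= n < N) iter n K v @[N --> \oo] --> L v].
Proof.
have Kc : continuous K.
  apply: bounded_linear_continuous; apply/linear_boundedP.
  exists q; split; first exact: num_real.
  by move=> r qr x; rewrite (le_trans (Kq x))// ler_wpM2r// ltW.
split => //.
have SP n a u v : S (a *: u + v) n = a *: S u n + S v n.
  rewrite /S /series /= scaler_sumr -big_split/=.
  by apply: eq_bigr => i _; rewrite iter_linear.
have [L LE] : exists L : {linear V -> V}, L =1 (fun v => limn (S v)).
  apply: linear_function => a u v; apply: cvg_lim => //.
  under eq_cvg do rewrite SP.
  by apply: cvgD; [apply: cvgZl_tmp|]; exact: is_cvg_neumann.
have cL v : S v n @[n --> \oo] --> L v by rewrite LE; exact: is_cvg_neumann.
have Lb v : `|L v| <= (1 - q)^-1 * `|v|.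
  have h : `|S v n| @[n --> \oo] --> `|L v| by exact: cvg_norm.
  apply: (cvgr_to_le h).
  by near=> n; exact: neumann_partial_le.
have LK v : L v - K (L v) = v.
  have h1 : S v n - K (S v n) @[n --> \oo] --> L v - K (L v).
    by apply: cvgB => //; apply: continuous_cvg => //; exact: Kc.
  have h2 : S v n - K (S v n) @[n --> \oo] --> v - 0.
    under eq_cvg do rewrite neumann_telescope.
    by apply: cvgB; [exact: cvg_cst|exact: cvg_iter0].
  by rewrite subr0 in h2; exact: cvg_unique h1 h2.
have SK n v : S (v - K v) n = v - iter n K v.
  rewrite -neumann_telescope /S /series /= raddf_sum -sumrB.
  apply: eq_bigr => i _; rewrite -iterS iterSr.
  by rewrite -scaleN1r addrC iter_linear scaleN1r addrC.
have KL v : L (v - K v) = v.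
  have h2 : S (v - K v) n @[n --> \oo] --> v - 0.
    under eq_cvg do rewrite SK.
    by apply: cvgB; [exact: cvg_cst|exact: cvg_iter0].
  by rewrite subr0 in h2; exact: cvg_unique (cL _) h2.
exists L; split => //.
- apply: bounded_linear_continuous; apply/linear_boundedP.
  exists (1 - q)^-1; split; first exact: num_real.
  by move=> r qr x; rewrite (le_trans (Lb x))// ler_wpM2r// ltW.
- move=> e e0; have q1' : 0 < 1 - q by rewrite subr_gt0.
  have : q ^+ n @[n --> \oo] --> 0 by apply: cvg_expr; rewrite ger0_norm.
  move=> /cvgrPdist_le /(_ (e * (1 - q))) /(_ (mulr_gt0 e0 q1')).
  apply: filterS => N; rewrite sub0r normrN ger0_norm ?exprn_ge0// => hN v.
  rewrite -[X in X - _]/(S v N) -{1}[v]LK SK addrAC subrr sub0r normrN.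
  rewrite (le_trans (norm_iter_le _ _))//.
  rewrite (le_trans (ler_wpM2l (exprn_ge0 _ q0) (Lb v)))// mulrA ler_wpM2r//.
  by rewrite ler_pdivrMr.
Unshelve. all: by end_near. Qed.
End Neumann.

(** * Sums of products over finite subsets *)

Section SubsetSums.
Local Open Scope fset_scope.
Local Open Scope ring_scope.

Lemma big_fpowersetU1 (T : choiceType) (R : nmodType) (a : T) (U : {fset T})
    (F : {fset T} -> R) : a \notin U ->
  \sum_(J <- fpowerset (a |` U)) F J =
  \sum_(J <- fpowerset U) (F J + F (a |` J)).
Proof.
move=> aU; rewrite (@big_fsetID _ _ _ _ (fun J : {fset T} => a \notin J)) [RHS]big_split /=.
congr (_ + _).
  apply: eq_fbigl => J; rewrite !inE !fpowersetE /=; apply/andP/idP => [[JU aJ]|JU].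
    apply/fsubsetP => s sJ; have := fsubsetP JU s sJ; rewrite !inE => /orP[/eqP sa|//].
    by rewrite -sa sJ in aJ.
  split; first exact: fsubset_trans (fsubsetUr _ _).
  by apply: contra aU; exact: (fsubsetP JU).
transitivity (\sum_(J <- [fset a |` J | J in fpowerset U]) F J); last first.
  rewrite big_imfset//=.
  move=> J J'; rewrite !fpowersetE => JU J'U /(congr1 (fun A => A `\ a)).
  by rewrite !fsetU1K//; apply: contra aU; apply/fsubsetP.
apply: eq_fbigl => J; rewrite !inE negbK fpowersetE.
apply/andP/imfsetP => /= [[JU aJ]|[J' + ->]].
  exists (J `\ a); last by rewrite fsetD1K.
  by rewrite fpowersetE fsubDset.
by rewrite fpowersetE => J'U; rewrite fset1U1; split => //; rewrite fsetUS.
Qed.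

Lemma sum_fpowerset_prod (R : comPzRingType) (T : choiceType) (k : T -> R)
    (U : {fset T}) :
  \sum_(J <- fpowerset U) \prod_(s <- J) k s = \prod_(s <- U) (1 + k s).
Proof.
elim/fset1U_rect: U => [|a U aU ih].
  by rewrite fpowerset0 !big_seq_fset1 !big_seq_fset0.
rewrite big_fpowersetU1// big_fsetU1//= -ih mulr_sumr.
rewrite big_seq [RHS]big_seq; apply: eq_bigr => J; rewrite fpowersetE => JU.
rewrite big_fsetU1/= ?mulrDl ?mul1r//.
by apply: contra aU; exact: (fsubsetP JU).
Qed.

(** Together with the term of the empty set, the left-hand side is the product
    of the 1 + k s, and 1 + u <= exp u. *)
Lemma sum_prod_le_expR (R : realType) (T : choiceType) (k : T -> R) (C : R)
    (U : {fset T}) :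
  (forall s, 0 <= k s) -> \sum_(s <- U) k s <= C ->
  \sum_(J <- fpowerset U | J != fset0) \prod_(s <- J) k s <= expR C - 1.
Proof.
move=> k0 kC; rewrite lerBrDl.
have -> : 1 + \sum_(J <- fpowerset U | J != fset0) \prod_(s <- J) k s =
    \prod_(s <- U) (1 + k s).
  rewrite -sum_fpowerset_prod (@big_fsetD1 _ _ _ _ fset0) ?fpowersetE ?fsub0set//=.
  rewrite big_seq_fset0; congr (_ + _).
  rewrite big_fset_condE; apply: eq_fbigl => J.
  by rewrite !inE andbC.
apply: (@le_trans _ _ (\prod_(s <- U) expR (k s))).
  by apply: ler_prod => s _; rewrite expR_ge1Dx addr_ge0.
by rewrite -expR_sum ler_expR.
Qed.

(** Superadditivity of u |-> exp u - 1 on nonnegative reals: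
    (exp u - 1) (exp v - 1) >= 0. *)
Lemma sum_expRB1_le (R : realType) (T : Type) (r : seq T) (f : T -> R) :
  (forall s, 0 <= f s) ->
  \sum_(s <- r) (expR (f s) - 1) <= expR (\sum_(s <- r) f s) - 1.
Proof.
move=> f0; elim: r => [|s r ih]; first by rewrite !big_nil expR0 subrr.
rewrite !big_cons expRD.
have h1 : 1 <= expR (f s) by rewrite -expR0 ler_expR.
have h2 : 1 <= expR (\sum_(j <- r) f j) by rewrite -expR0 ler_expR sumr_ge0.
nra.
Qed.

(** A finite family of subsets J lives in the powerset of its union U, so the
    bound over a finite ground set passes to the supremum.  Only finite unions of
    members of D need a bound on the sum of k; this allows D to avoid a site
    where k is not controlled. *)
Lemma esum_prod_le_expR (R : realType) (T : choiceType) (k : T -> R) (C : R)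
    (D : set {fset T}) :
  (forall s, 0 <= k s) ->
  (forall J, D J -> J != fset0) ->
  (forall U : {fset T}, (forall s, s \in U -> exists2 J, D J & s \in J) ->
     \sum_(s <- U) k s <= C) ->
  (\esum_(J in D) (\prod_(s <- J) k s)%:E <= (expR C - 1)%:E)%E.
Proof.
move=> k0 DN kC; apply: ge_ereal_sup => _ [A [finA AD] <-].
rewrite fsbig_finite//= sumEFin lee_fin.
pose U : {fset T} := \bigcup_(J <- fset_set A) J.
have memA J : (J \in fset_set A) = (J \in A) by rewrite in_fset_set.
have AU J : J \in fset_set A -> J `<=` U.
  by move=> JA; exact: bigfcup_sup.
apply: le_trans (_ : _ <= \sum_(J <- fpowerset U | J != fset0) \prod_(s <- J) k s) _.
  rewrite [leRHS]big_fset_condE.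
  rewrite [leRHS](@big_fsetID _ _ _ _ (fun J => J \in fset_set A))/=.
  rewrite [X in X + _](_ : _ = \sum_(J <- fset_set A) \prod_(s <- J) k s).
    by rewrite lerDl sumr_ge0// => J _; apply: prodr_ge0.
  apply: eq_fbigl => J; rewrite !inE fpowersetE andbC.
  case: (boolP (J \in fset_set A)) => //= JA; rewrite AU// DN//.
  by apply: AD; rewrite -in_setE -memA.
apply: sum_prod_le_expR => //; apply: kC => s /bigfcupP[J].
rewrite andbT => JA sJ; exists J => //.
by apply: AD; rewrite -in_setE -memA.
Qed.

End SubsetSums.

(** * Absolutely summable real families *)

Section RealSum.
Variables (R : realType) (T : choiceType) (D : set T).
Implicit Types f g : T -> R.

Lemma summable_fin f : (forall i, 0 <= f i) -> summable D (EFin \o f) ->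
  \esum_(i in D) (f i)%:E \is a fin_num.
Proof.
move=> f0; rewrite summableE; congr (_ \is a fin_num).
by apply: eq_esum => i _; rewrite /= ger0_norm.
Qed.

Lemma le_summable f g : (forall i, D i -> `|f i| <= `|g i|) ->
  summable D (EFin \o g) -> summable D (EFin \o f).
Proof.
by move=> fg; apply: le_lt_trans; apply: le_esum => i Di; rewrite lee_fin fg.
Qed.

(** [rsum] is defined from the positive and negative parts of its argument; any
    other decomposition into summable nonnegative families gives the same value. *)
Lemma rsum_diff f g : (forall i, 0 <= f i) -> (forall i, 0 <= g i) ->
  summable D (EFin \o f) -> summable D (EFin \o g) ->
  rsum D (fun i => f i - g i) =
  fine (\esum_(i in D) (f i)%:E) - fine (\esum_(i in D) (g i)%:E).
Proof.
move=> f0 g0 sf sg.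
have sfg := summableB sf sg.
rewrite -fineB ?summable_fin//.
rewrite -(@esumB _ _ D (EFin \o f) (EFin \o g))//; do ?by move=> i _ /=; rewrite lee_fin.
rewrite fineB//.
- have := summable_funepos sfg; rewrite summableE; congr (_ \is a fin_num).
  by apply: eq_esum => i _; rewrite gee0_abs.
- have := summable_funeneg sfg; rewrite summableE; congr (_ \is a fin_num).
  by apply: eq_esum => i _; rewrite gee0_abs.
Qed.

Lemma esumZl (a : R) (f : T -> R) : 0 <= a ->
  (\esum_(i in D) (a * f i)%:E = a%:E * \esum_(i in D) (f i)%:E)%E.
Proof.
move=> a0; rewrite /esum -ereal_supZl//; last first.
  by apply/set0P; exists (\sum_(i \in set0) (f i)%:E); exists set0 => //; exact: fsets_set0.
congr ereal_sup; apply/seteqP; split.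
  move=> _ [A [finA AD] <-]; exists (\sum_(i \in A) (f i)%:E); first by exists A.
  by rewrite !fsbig_finite// !sumEFin -mulr_sumr EFinM.
move=> _ [_ [A [finA AD] <-] <-]; exists A => //.
by rewrite !fsbig_finite// !sumEFin -mulr_sumr EFinM.
Qed.

Lemma summableZ (a : R) f : summable D (EFin \o f) ->
  summable D (EFin \o (fun i => a * f i)).
Proof.
rewrite !summableE => sf.
rewrite [X in X \is a _](_ : _ = (`|a|%:E * \esum_(i in D) `|f i|%:E)%E) ?fin_numM//.
by rewrite -esumZl//; apply: eq_esum => i _ /=; rewrite normrM.
Qed.

Let pos f i := Num.max (f i) 0.
Let pos0 f i : 0 <= pos f i. Proof. by rewrite le_max lexx orbT. Qed.
Let posB f i : f i = pos f i - pos (- f) i.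
Proof.
rewrite /pos /= [(- f) i]/(- f i).
by case: (leP (f i) 0); case: (leP (- f i) 0); lra.
Qed.
Let pos_le f i : `|pos f i| <= `|f i|.
Proof. by rewrite ger0_norm// ge_max normr_ge0 ler_norm. Qed.
Let sum_pos f : summable D (EFin \o f) ->
  summable D (EFin \o pos f) /\ summable D (EFin \o pos (- f)).
Proof.
move=> sf; split; apply: le_summable sf => i _ //.
by rewrite (le_trans (pos_le _ _))// normrN.
Qed.
Let rsumE f : summable D (EFin \o f) ->
  rsum D f = fine (\esum_(i in D) (pos f i)%:E) - fine (\esum_(i in D) (pos (- f) i)%:E).
Proof.
move=> /sum_pos[sp sn]; rewrite -rsum_diff//; congr rsum.
by apply/funext => i; exact: posB.
Qed.

Lemma rsumD f g : summable D (EFin \o f) -> summable D (EFin \o g) ->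
  rsum D (fun i => f i + g i) = rsum D f + rsum D g.
Proof.
move=> sf sg; have [sfp sfn] := sum_pos sf; have [sgp sgn] := sum_pos sg.
have -> : (fun i => f i + g i) =
    (fun i => (pos f i + pos g i) - (pos (- f) i + pos (- g) i)).
  by apply/funext => i; rewrite opprD addrACA -!posB.
have EE (u v : T -> R) : (forall i, 0 <= u i) -> (forall i, 0 <= v i) ->
    summable D (EFin \o u) -> summable D (EFin \o v) ->
    fine (\esum_(i in D) (u i + v i)%:E) =
    fine (\esum_(i in D) (u i)%:E) + fine (\esum_(i in D) (v i)%:E).
  move=> u0 v0 su sv; rewrite -fineD ?summable_fin//; congr fine.
  by rewrite -esumD// => i _; rewrite lee_fin.
rewrite rsum_diff ?EE ?rsumE//; first lra.
- by move=> i; exact: addr_ge0.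
- by move=> i; exact: addr_ge0.
- exact: (summableD sfp sgp).
- exact: (summableD sfn sgn).
Qed.

Lemma rsumN f : summable D (EFin \o f) -> rsum D (fun i => - f i) = - rsum D f.
Proof.
move=> sf; have [sfp sfn] := sum_pos sf.
rewrite (rsumE sf) opprB -rsum_diff//.
by congr rsum; apply/funext => i; rewrite (posB f i) opprB.
Qed.

Lemma rsumZ (a : R) f : summable D (EFin \o f) ->
  rsum D (fun i => a * f i) = a * rsum D f.
Proof.
move=> sf; have [sfp sfn] := sum_pos sf.
have pZ (b : R) : 0 <= b -> rsum D (fun i => b * f i) = b * rsum D f.
  move=> b0.
  have -> : (fun i => b * f i) = (fun i => b * pos f i - b * pos (- f) i).
    by apply/funext => i; rewrite -mulrBr -posB.
  rewrite rsum_diff ?rsumE//; try exact: summableZ; try by move=> i; exact: mulr_ge0.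
  by rewrite !esumZl// !fineM ?summable_fin// mulrBr.
have [a0|a0] := leP 0 a; first exact: pZ.
have -> : (fun i => a * f i) = (fun i => - (- a * f i)).
  by apply/funext => i; rewrite mulNr opprK.
by rewrite rsumN ?pZ ?mulNr ?opprK//; [lra|exact: summableZ].
Qed.

Lemma le_norm_rsum f : summable D (EFin \o f) ->
  (`|rsum D f|%:E <= \esum_(i in D) `|f i|%:E)%E.
Proof.
move=> sf; have [sfp sfn] := sum_pos sf.
have -> : \esum_(i in D) `|f i|%:E = 
    ((\esum_(i in D) (pos f i)%:E) + \esum_(i in D) (pos (- f) i)%:E)%E.
  rewrite -esumD => [|i _|i _]; try by rewrite lee_fin.
  apply: eq_esum => i _; rewrite -EFinD; congr EFin.
  rewrite /pos /= [(- f) i]/(- f i).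
  case: (ger0P (f i)) => h1; case: (leP (f i) 0) => h2; case: (leP (- f i) 0) => h3; lra.
have ep g : (0 <= \esum_(i in D) (pos g i)%:E)%E.
  by apply: esum_ge0 => i _; rewrite lee_fin.
rewrite rsumE// -[leRHS]fineK ?fin_numD ?summable_fin// fineD ?summable_fin//.
rewrite lee_fin (le_trans (ler_normB _ _))//.
by rewrite !ger0_norm ?fine_ge0.
Qed.
End RealSum.

(** * The weighted average over the values at one site *)

Lemma sum_neq_card (R : realType) (X : finType) (v : X) (c : R) :
  \sum_(a | a != v) c = (#|X|%:R - 1) * c.
Proof.
rewrite sumr_const -[LHS]mulr_natl; congr (_ * c).
by rewrite -[in RHS](cardC (pred1 v)) card1 natrD addrAC subrr add0r; congr _%:R.
Qed.

(** With W the sum of w over the values a <> v and H that of w a |G a|, the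
    inner term is at most |s| + (1 + W) |G a| + H.  Its weighted sum is at most
    W / (1 + W) |s| + (1 + W / (1 + W)) H; then H <= e sum |G a|, and W / (1 + W)
    increases with W <= e (|X| - 1).  The value v plays the vacuum, s the term
    S phi and G the values of G phi as the spin at the smallest site varies. *)
Lemma one_site_bound (R : realType) (X : finType) (v : X) (e : R) (w G : X -> R) (s : R) :
  w v = 1 -> (forall a, 0 < w a <= e) ->
  \sum_(a | a != v)
     w a / (\sum_b w b) *
       `|s + (G a + \sum_(b | b != v) w b * (G a - G b))| <=
  e * (#|X|%:R - 1) / (1 + e * (#|X|%:R - 1)) * `|s| +
  e * (1 + 2 * (e * (#|X|%:R - 1))) / (1 + e * (#|X|%:R - 1)) *
    \sum_(a | a != v) `|G a|.
Proof.
move=> wv we.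
set N : R := #|X|%:R - 1.
have N0 : 0 <= N by rewrite subr_ge0 ler1n; apply/card_gt0P; exists v.
have w0 a : 0 < w a by have /andP[] := we a.
have wle a : w a <= e by have /andP[] := we a.
have e0 : 0 < e := lt_le_trans (w0 v) (wle v).
pose W := \sum_(a | a != v) w a.
have -> : \sum_b w b = 1 + W by rewrite (bigD1 v)//= wv.
have W0 : 0 <= W by apply: sumr_ge0 => a _; exact: ltW.
have WeN : W <= e * N.
  by rewrite mulrC -(sum_neq_card v) ler_sum.
have pW : 0 < 1 + W by lra.
have pN : 0 < 1 + e * N by have := mulr_ge0 (ltW e0) N0; lra.
pose H := \sum_(a | a != v) w a * `|G a|.
have H0 : 0 <= H by apply: sumr_ge0 => a _; rewrite mulr_ge0// ltW.
have HG : H <= e * \sum_(a | a != v) `|G a|.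
  by rewrite mulr_sumr; apply: ler_sum => a _; rewrite ler_wpM2r.
have T_le a : `|G a + \sum_(b | b != v) w b * (G a - G b)| <= (1 + W) * `|G a| + H.
  under eq_bigr do rewrite mulrBr.
  rewrite sumrB -mulr_suml -/W addrA -[X in X + _ - _]mul1r -mulrDl.
  rewrite (le_trans (ler_normB _ _))// normrM gtr0_norm// lerD2l.
  rewrite (le_trans (ler_norm_sum _ _ _))//; apply: ler_sum => b _.
  by rewrite normrM gtr0_norm.
apply: (@le_trans _ _ (\sum_(a | a != v)
   (w a / (1 + W) * `|s| + (w a * `|G a| + w a / (1 + W) * H)))).
  apply: ler_sum => a _.
  have -> : w a / (1 + W) * `|s| + (w a * `|G a| + w a / (1 + W) * H) =
    w a / (1 + W) * (`|s| + ((1 + W) * `|G a| + H)).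
    by field; rewrite gt_eqF.
  apply: ler_wpM2l; first by rewrite divr_ge0// ltW.
  by rewrite (le_trans (ler_normD _ _))// lerD2l; exact: T_le.
rewrite !big_split /= -!mulr_suml -/W -/H.
have frac : W / (1 + W) <= e * N / (1 + e * N).
  by rewrite ler_pdivrMr// mulrAC ler_pdivlMr//; nra.
rewrite lerD ?ler_wpM2r//.
have -> : H + W / (1 + W) * H = (1 + W / (1 + W)) * H by ring.
have -> : e * (1 + 2 * (e * N)) / (1 + e * N) = (1 + e * N / (1 + e * N)) * e.
  by field; rewrite gt_eqF.
rewrite -mulrA ler_pM//; first by rewrite addr_ge0// divr_ge0// ltW.
by rewrite lerD2l.
Qed.

(** * Configurations without vacuum components *)

Section Configurations.
Local Open Scope fset_scope.
Local Open Scope fmap_scope.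
Local Open Scope ring_scope.
Variables (R : realType) (d : nat) (X : finType) (theta : lattice d -> X).
Implicit Types (L J : {fset lattice d}) (x y z : fconfig d X) (F : fconfig d X -> R).

(** The conditions of [starred] apart from nonemptiness.  Removing the smallest
    site of a one-point set leaves the empty configuration, which is not in L_*,
    so sums are taken over finite maps rather than over [Lstar]. *)
Definition vacuum_free x : Prop := forall s, x.[? s] != Some (theta s).

Definition vfconfig L : set (fconfig d X) := [set x | domf x = L /\ vacuum_free x].

Lemma starredE x : starred theta x <-> domf x != fset0 /\ vacuum_free x.
Proof.
split=> [/andP[x0 /forallP h]|[x0 h]].
  split => // s; case: fndP => // sx.
  by apply: contra (h [` sx]) => /eqP[<-].
apply/andP; split => //; apply/forallP => s.
by apply: contra (h (val s)) => /eqP xs; rewrite -Some_fnd xs.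
Qed.

Lemma finite_vfconfig L : finite_set (vfconfig L).
Proof.
apply: (@sub_finite_set _ _ (range (fun f : {ffun L -> X} => FinMap f))).
  by move=> [A f] [/= AL _]; case: _ / AL; exists f.
exact/finite_image/finite_finset.
Qed.

Lemma fnd_domF x L s : domf x = L -> s \notin L -> x.[? s] = None.
Proof. by move=> <-; exact: not_fnd. Qed.

Lemma sum_Xstar L F : L != fset0 ->
  \sum_(u \in Xstar theta L) F (val u) = \sum_(x \in vfconfig L) F x.
Proof.
move=> L0; rewrite (@reindex_fsbig _ _ _ _ _ val (Xstar theta L) (vfconfig L))//; split.
- by move=> u /= uL; split => //; have /starredE[] := valP u.
- by move=> u v _ _; exact: val_inj.
- move=> x [xL xv]; have sx : starred theta x by apply/starredE; rewrite xL.
  by exists (exist _ x sx).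
Qed.

Lemma sum_vfconfig_set L t F : t \notin L ->
  \sum_(x \in vfconfig (t |` L)) F x =
  \sum_(x \in vfconfig L) \sum_(a | a != theta t) F x.[t <- a].
Proof.
move=> tL.
have sumE x : \sum_(a | a != theta t) F x.[t <- a] =
    \sum_(a \in [set a | a != theta t]%classic) F x.[t <- a].
  by rewrite bigfs ?index_enum_uniq// => a _; rewrite mem_index_enum.
under [RHS]eq_fsbigr do rewrite sumE.
rewrite pair_fsbig; [|exact: finite_vfconfig|exact: finite_finset].
apply: reindex_fsbig; split.
- move=> [x a] [/= [xL xv]] /= at0; split; first by rewrite dom_setf xL.
  move=> s; rewrite fnd_set; case: (eqVneq s t) => [->|_]; last exact: xv.
  by apply: contra at0 => /eqP[->].
- move=> [x a] [y b]; rewrite !inE => -[/= [xL _] _] [/= [yL _] _] xy.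
  have ab : a = b.
    by have := congr1 (fun z => z.[? t]) xy; rewrite !fnd_set eqxx => -[].
  rewrite ab; congr pair; apply/fmapP => s.
  have := congr1 (fun z => z.[? s]) xy; rewrite !fnd_set.
  by case: (eqVneq s t) => // -> _; rewrite (fnd_domF xL)// (fnd_domF yL).
- move=> z [zL zv].
  have tz : t \in domf z by rewrite zL fset1U1.
  exists (z.[~ t], z.[tz]%fmap) => /=.
    split => /=; [split|].
    + by rewrite domf_rem zL fsetU1K.
    + by move=> s; rewrite fnd_rem1; case: ifP => // _; exact: zv.
    + by apply: contra (zv t) => /eqP zt; rewrite in_fnd zt.
  apply/fmapP => s; rewrite fnd_set fnd_rem1.
  by case: eqP => // ->; rewrite in_fnd.
Qed.

Lemma sum_vfconfig_cat L J F : [disjoint L & J] ->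
  \sum_(x \in vfconfig L) \sum_(y \in vfconfig J) F (x + y)%fset =
  \sum_(z \in vfconfig (L `|` J)) F z.
Proof.
move=> LJ.
have catE x y s : domf y = J ->
    (x + y)%fset.[? s] = if s \in J then y.[? s] else x.[? s].
  by move=> <-; exact: fnd_cat.
rewrite pair_fsbig; [|exact: finite_vfconfig..].
apply/esym/reindex_fsbig; split.
- move=> [x y] [/= [xL xv]] /= [yJ yv]; split; first by rewrite domf_cat xL yJ.
  by move=> s; rewrite /= catE//; case: ifP.
- move=> [x y] [x' y']; rewrite !inE => -[/= [xL _] [yJ _]] [/= [xL' _] [yJ' _]] xy.
  congr pair; apply/fmapP => s; have := congr1 (fun z => z.[? s]) xy;
    rewrite /= !catE//; case: (boolP (s \in J)) => // sJ _.
    have sL : s \notin L by rewrite fdisjoint_sym in LJ; exact: (fdisjointP LJ).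
    by rewrite (fnd_domF xL)// (fnd_domF xL').
  by rewrite (fnd_domF yJ)// (fnd_domF yJ').
- move=> z [zL zv].
  have dL : domf z.[& L] = L.
    by rewrite domf_restrict zL; apply/fsetIidPl/fsubsetUl.
  have dJ : domf z.[& J] = J.
    by rewrite domf_restrict zL; apply/fsetIidPl/fsubsetUr.
  exists (z.[& L], z.[& J]).
    by split; split => // s; rewrite fnd_restrict; case: ifP.
  apply/fmapP => s; rewrite catE// !fnd_restrict.
  case: (boolP (s \in J)) => // sJ; case: (boolP (s \in L)) => // sL.
  by rewrite (fnd_domF zL)// in_fsetU negb_or sL sJ.
Qed.

Lemma ev_val (phi : Lstar theta -> R) u : ev phi (val u) = phi u.
Proof. by rewrite /ev valK. Qed.

Lemma sum_ev_normL (phi : Lstar theta -> R) L : L != fset0 ->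
  \sum_(x \in vfconfig L) `|ev phi x| = normL L phi.
Proof.
move=> L0; rewrite -(sum_Xstar (fun x => `|ev phi x|))//.
by apply: eq_fsbigr => u _; rewrite ev_val.
Qed.

Lemma ev_linear (phi psi : Lstar theta -> R) a x :
  ev (a *: phi + psi) x = a * ev phi x + ev psi x.
Proof. by rewrite /ev; case: insubP => //= _; rewrite mulr0 addr0. Qed.

End Configurations.

(** * The norm of the Kirkwood-Salsburg operator *)

Section Operator.
Local Open Scope fset_scope.
Local Open Scope fmap_scope.
Local Open Scope ring_scope.
Variables (R : realType) (d : nat) (X : finType) (theta : lattice d -> X).
Variables (Delta : energy_field R d X) (le : rel (lattice d)).
Hypothesis cocycle : forall t (xbar : config X (~` [set t])%classic) (x u y : X),
  Delta xbar x u = Delta xbar x y + Delta xbar y u.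
Hypothesis norm_fin : tef_norm Delta \is a fin_num.
Hypothesis D_fin : tef_D theta Delta \is a fin_num.
Implicit Types (phi psi : Lstar theta -> R) (I J L : {fset lattice d}) (x : fconfig d X).

Local Notation vfconfig := (vfconfig theta).
Local Notation N := (#|X|%:R - 1 : R).
Local Notation e := (expR (fine (tef_norm Delta))).
Local Notation E := (expR (expR (fine (tef_D theta Delta)) - 1) - 1).

Lemma esup_ge (T : Type) (f : T -> \bar R) i : (f i <= esup f)%E.
Proof. by apply: ereal_sup_ubound; exists i. Qed.

Lemma Delta_le_norm t (xbar : config X (~` [set t])%classic) (v u : X) :
  `|Delta xbar v u| <= fine (tef_norm Delta).
Proof.
rewrite -lee_fin fineK//.
apply: le_trans (esup_ge _ t); apply: le_trans (esup_ge _ v).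
by apply: le_trans (esup_ge _ u); apply: le_trans (esup_ge _ xbar).
Qed.

Lemma Delta_diag t (xbar : config X (~` [set t])%classic) (u : X) : Delta xbar u u = 0.
Proof. by have := cocycle xbar u u u; lra. Qed.

(** The s-term of the sum defining D: how much the spin a at t changes the
    energies at s in the vacuum. *)
Definition einfluence (t : lattice d) (a : X) (s : lattice d) : \bar R :=
  esup (fun y : X => `|Delta (vac theta s [fmap].[t <- a]) y (theta s)
        - Delta (vac theta s [fmap]) y (theta s)|%:E).
Definition influence t a s : R := fine (einfluence t a s).

Lemma einfluence_ge0 t a s : (0 <= einfluence t a s)%E.
Proof. by apply: le_trans (esup_ge _ (theta s)); rewrite lee_fin. Qed.

Lemma influence_ge0 t a s : 0 <= influence t a s.
Proof. exact/fine_ge0/einfluence_ge0. Qed.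

Lemma esum_einfluence_le t a :
  (\esum_(s in [set~ t]%classic) einfluence t a s <= tef_D theta Delta)%E.
Proof. by apply: le_trans (esup_ge _ t); exact: le_trans (esup_ge _ a). Qed.

Lemma sum_einfluence_le t a (U : {fset lattice d}) : t \notin U ->
  (\sum_(s <- U) einfluence t a s <= tef_D theta Delta)%E.
Proof.
move=> tU; apply: le_trans (esum_einfluence_le t a).
rewrite fsbig_seq ?fset_uniq//=; apply: esum_ge; exists [set` U] => //.
by split => // s /= sU st; rewrite -st sU in tU.
Qed.

(** The sum defining D omits only the site t, so every other influence is
    finite as one of its terms. *)
Lemma einfluence_fin t a s : s != t -> einfluence t a s \is a fin_num.
Proof.
move=> st; rewrite ge0_fin_numE ?einfluence_ge0//.
have := @sum_einfluence_le t a [fset s]; rewrite inE eq_sym st => /(_ isT).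
rewrite big_seq_fset1 => /le_lt_trans; apply.
rewrite -ge0_fin_numE// (le_trans _ (esum_einfluence_le t a))//.
by apply: esum_ge0 => r _; exact: einfluence_ge0.
Qed.

Lemma sum_influence_le t a (U : {fset lattice d}) : t \notin U ->
  \sum_(s <- U) influence t a s <= fine (tef_D theta Delta).
Proof.
move=> tU; rewrite -lee_fin fineK// -sumEFin.
apply: le_trans (sum_einfluence_le a tU).
rewrite big_seq [leRHS]big_seq; apply: lee_sum => s sU.
by rewrite fineK// einfluence_fin//; apply: contraNneq tU => <-.
Qed.

Lemma le_influence t a s y : s != t ->
  `|Delta (vac theta s [fmap].[t <- a]) y (theta s)
     - Delta (vac theta s [fmap]) y (theta s)| <= influence t a s.
Proof.
move=> st; rewrite -lee_fin fineK ?einfluence_fin//.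
exact: (esup_ge (fun y : X => `|Delta (vac theta s [fmap].[t <- a]) y (theta s)
        - Delta (vac theta s [fmap]) y (theta s)|%:E) y).
Qed.

(** Bounds the s-factor of the kernel K_{t U J} (a y) uniformly in y. *)
Definition activity t a s := expR (influence t a s) - 1.

Lemma activity_ge0 t a s : 0 <= activity t a s.
Proof. by rewrite subr_ge0 -expR0 ler_expR influence_ge0. Qed.

(** For u < 0, 1 - exp u <= - u <= v <= exp v - 1. *)
Lemma norm_expRB1_le (u v : R) : `|u| <= v -> `|expR u - 1| <= expR v - 1.
Proof.
move=> uv; have v0 := le_trans (normr_ge0 u) uv.
have h1 := expR_ge1Dx v; have h2 := expR_ge1Dx (- v).
have [u0|u0] := leP 0 u.
  rewrite ger0_norm ?subr_ge0 -?expR0 ?ler_expR// lerD2r ler_expR.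
  exact: le_trans (ler_norm _) uv.
rewrite ltr0_norm ?subr_lt0 ?expR_lt1//.
have h3 := expR_ge1Dx u; rewrite ltr0_norm// in uv.
lra.
Qed.

Lemma kernelK_le t a y : t \notin domf y ->
  `|kernelK theta Delta t a y| <= \prod_(s <- domf y) activity t a s.
Proof.
move=> ty; rewrite /kernelK normr_prod big_seq_fsetE /=.
apply: ler_prod => s _; rewrite normr_ge0 /=; apply: norm_expRB1_le.
by apply: le_influence; apply: contraNneq ty => <-; exact: valP.
Qed.

Definition disjoint_from I : set {fset lattice d} :=
  [set J | J != fset0 /\ [disjoint J & I]%fset].

(** A set J that is disjoint from I avoids t, so the activities over a finite
    union of such sets sum to at most exp D - 1. *)
Lemma esum_activity_le t a I : t \in I ->
  (\esum_(J in disjoint_from I) (\prod_(s <- J) activity t a s)%:E <= E%:E)%E.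
Proof.
move=> tI; apply: esum_prod_le_expR.
- by move=> s; exact: activity_ge0.
- by move=> J [].
- move=> U UI; apply: le_trans (sum_expRB1_le _ _) _.
    by move=> s; exact: influence_ge0.
  rewrite lerD2r ler_expR; apply: sum_influence_le.
  apply/negP => /UI[J [_ /fdisjointP JI] /JI].
  by rewrite tI.
Qed.

(** [site x] depends on x only through its support; changing the spin there
    leaves the site unchanged. *)
Definition minsite I : lattice d := head 0 (sort le I).

Lemma minsite_in I : I != fset0 -> minsite I \in I.
Proof.
move=> I0; rewrite -(mem_sort le) /minsite.
case: (sort le I) (size_sort le I) => [/esym/eqP|t s _ /=]; last exact: mem_head.
by rewrite cardfs_eq0 (negbTE I0).
Qed.

Section FixedSet.
Variable I : {fset lattice d}.
Hypothesis I0 : I != fset0.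
Let t := minsite I.
Let tI : t \in I. Proof. exact: minsite_in. Qed.

(** The ingredients of the operator in the coordinates (x', a) of a
    configuration on I. *)
Section Coordinates.
Variables (x' : fconfig d X) (a : X).
Hypothesis domx' : domf x' = I `\ t.

Lemma domf_min : domf x'.[t <- a] = I.
Proof. by rewrite dom_setf domx' fsetD1K. Qed.

Lemma site_min : site le x'.[t <- a] = t.
Proof. by rewrite /site domf_min. Qed.

Lemma spin_min : spin theta le x'.[t <- a] = a.
Proof. by rewrite /spin site_min fnd_set eqxx. Qed.

Lemma rest_min : rest le x'.[t <- a] = x'.
Proof.
rewrite /rest site_min; apply/fmapP => s; rewrite fnd_rem1 fnd_set.
case: eqVneq => // ->; rewrite (fnd_domF domx')//.
by rewrite !inE eqxx.
Qed.

Lemma weight_min b :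
  weight theta Delta le x'.[t <- a] b = expR (Delta (vac theta t x') b (theta t)).
Proof. by rewrite /weight site_min rest_min. Qed.

Lemma gammaf_min :
  gammaf theta Delta le x'.[t <- a] =
  expR (Delta (vac theta t x') a (theta t)) /
  \sum_b expR (Delta (vac theta t x') b (theta t)).
Proof.
rewrite /gammaf spin_min weight_min; congr (_ / _).
by apply: eq_bigr => b _; exact: weight_min.
Qed.

Lemma Sop_min phi :
  Sop le phi x'.[t <- a] = if (1 < #|` I|)%N then ev phi x' else 0.
Proof. by rewrite /Sop domf_min rest_min. Qed.

Lemma Top_min phi :
  Top Delta le phi x'.[t <- a] = Gop Delta le phi x'.[t <- a] +
  \sum_(b : X | b != theta t) expR (Delta (vac theta t x') b (theta t)) *
    (Gop Delta le phi x'.[t <- a] - Gop Delta le phi x'.[t <- b]).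
Proof.
rewrite /Top site_min rest_min; congr (_ + _).
by apply: eq_bigr => b _; rewrite weight_min.
Qed.

Lemma Gdom_min : Gdom x'.[t <- a] = disjoint_from I.
Proof. by rewrite /Gdom domf_min. Qed.

Lemma Gterm_min phi J : J != fset0 ->
  Gterm Delta le phi x'.[t <- a] J =
  \sum_(y \in vfconfig J) kernelK theta Delta t a y *
    (ev phi (x' + y)%fset
     - \sum_(b : X | b != theta t) ev phi (x' + y)%fset.[t <- b]).
Proof.
move=> J0; rewrite -(@sum_Xstar R _ _ _ J (fun y => kernelK theta Delta t a y *
    (ev phi (x' + y)%fset
     - \sum_(b : X | b != theta t) ev phi (x' + y)%fset.[t <- b])))//.
by rewrite /Gterm site_min spin_min rest_min.
Qed.

End Coordinates.

Lemma vfconfig_split x : vfconfig I x ->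
  exists x' a, vfconfig (I `\ t) x' /\ x = x'.[t <- a].
Proof.
move=> [dx vx]; have tx : t \in domf x by rewrite dx.
exists x.[~ t], x.[tx]%fmap; split.
  split; first by rewrite domf_rem dx.
  by move=> s; rewrite fnd_rem1; case: ifP.
apply/fmapP => s; rewrite fnd_set fnd_rem1.
by case: (eqVneq s t) => // ->; rewrite in_fnd.
Qed.

Section Bound.
Variables (phi : Lstar theta -> R) (M : R).
Hypothesis phiM : forall L, L != fset0 -> normL L phi <= M.

Let M0 : 0 <= M. Proof. exact: le_trans (normL_ge0 I phi) (phiM I0). Qed.

(** The pairs (x', y) are the configurations on (I minus t) U J, and adding a
    spin at t gives those on I U J.  Each of the two terms of Gterm thus
    contributes one norm of phi on one finite set, which explains the factor 2. *)
Lemma sum_Gterm_le a J : disjoint_from I J ->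
  \sum_(x' \in vfconfig (I `\ t)) `|Gterm Delta le phi x'.[t <- a] J| <=
  2 * M * \prod_(s <- J) activity t a s.
Proof.
move=> [J0 JI].
have tJ : t \notin J.
  by apply/negP => tJ; move/fdisjointP : JI => /(_ _ tJ); rewrite tI.
have IJ : [disjoint I `\ t & J].
  by apply: fdisjointWl (fsubD1set _ _) _; rewrite fdisjoint_sym.
have tIJ : t \notin (I `\ t) `|` J by rewrite !inE eqxx.
have IJ0 : (I `\ t) `|` J != fset0.
  by have /fset0Pn[s sJ] := J0; apply/fset0Pn; exists s; rewrite inE sJ orbT.
set k := \prod_(s <- J) activity t a s.
have k0 : 0 <= k by apply: prodr_ge0 => s _; exact: activity_ge0.
pose H z := `|ev phi z| + \sum_(b | b != theta t) `|ev phi z.[t <- b]|.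
apply: (@le_trans _ _ (\sum_(x' \in vfconfig (I `\ t))
    \sum_(y \in vfconfig J) k * H (x' + y)%fset)).
  rewrite !fsbig_finite; [|exact: finite_vfconfig..].
  rewrite big_seq [leRHS]big_seq; apply: ler_sum => x'.
  rewrite in_fset_set ?inE; last exact: finite_vfconfig.
  move=> [dx' _]; rewrite Gterm_min//.
  rewrite !fsbig_finite; [|exact: finite_vfconfig..].
  rewrite (le_trans (ler_norm_sum _ _ _))//.
  rewrite big_seq [leRHS]big_seq; apply: ler_sum => y.
  rewrite in_fset_set ?inE; last exact: finite_vfconfig.
  move=> [dy _]; rewrite normrM; apply: ler_pM => //.
    by rewrite /k -dy; apply: kernelK_le; rewrite dy.
  rewrite (le_trans (ler_normB _ _))// lerD2l.
  exact: ler_norm_sum.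
rewrite (@sum_vfconfig_cat _ _ _ theta _ _ (fun z => k * H z))// -mulr_fsumr mulrC ler_wpM2r//.
rewrite fsbig_split; last exact: finite_vfconfig.
rewrite sum_ev_normL// -(@sum_vfconfig_set _ _ _ _ _ _ (fun z => `|ev phi z|))//.
rewrite sum_ev_normL; last by apply/fset0Pn; exists t; rewrite fset1U1.
by rewrite mulr2n mulrDl mul1r lerD// phiM//; apply/fset0Pn; exists t; rewrite fset1U1.
Qed.

Lemma esum_Gterm_le a :
  (\sum_(x' \in vfconfig (I `\ t))
     \esum_(J in disjoint_from I) `|Gterm Delta le phi x'.[t <- a] J|%:E
   <= (2 * M * E)%:E)%E.
Proof.
rewrite fsbig_finite; last exact: finite_vfconfig.
rewrite -esum_sum => [|i j _ _]; last by rewrite lee_fin.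
apply: (@le_trans _ _ (\esum_(J in disjoint_from I)
    (2 * M * \prod_(s <- J) activity t a s)%:E)).
  apply: le_esum => J JI.
  rewrite sumEFin lee_fin -fsbig_finite; last exact: finite_vfconfig.
  exact: sum_Gterm_le.
rewrite esumZl ?mulr_ge0// [leRHS]EFinM lee_wpmul2l ?lee_fin ?mulr_ge0//.
exact: esum_activity_le.
Qed.

Lemma summable_Gterm a x' : vfconfig (I `\ t) x' ->
  summable (disjoint_from I) (EFin \o Gterm Delta le phi x'.[t <- a]).
Proof.
move=> vx'; apply: (@le_lt_trans _ _ (2 * M * E)%:E); last exact: ltry.
apply: le_trans (esum_Gterm_le a).
rewrite (fsbigD1 x')//=; last exact: finite_vfconfig.
rewrite leeDl// fsume_ge0// => y _.
by apply: esum_ge0 => J _; rewrite lee_fin.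
Qed.

Lemma sum_Gop_le a :
  \sum_(x' \in vfconfig (I `\ t)) `|Gop Delta le phi x'.[t <- a]| <= 2 * M * E.
Proof.
rewrite -lee_fin; apply: le_trans (esum_Gterm_le a).
rewrite !fsbig_finite; [|exact: finite_vfconfig..].
rewrite -sumEFin big_seq [leRHS]big_seq; apply: lee_sum => x'.
rewrite in_fset_set ?inE; last exact: finite_vfconfig.
move=> vx'; rewrite /Gop Gdom_min ?(proj1 vx')//.
by apply: le_norm_rsum; exact: summable_Gterm.
Qed.

Let w x' b := expR (Delta (vac theta t x') b (theta t)).
Let w1 x' : w x' (theta t) = 1.
Proof. by rewrite /w Delta_diag expR0. Qed.
Let w_le x' b : 0 < w x' b <= e.
Proof.
rewrite expR_gt0/= ler_expR.
by rewrite (le_trans (ler_norm _))// Delta_le_norm.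
Qed.
Let N0 : 0 <= N.
Proof. by rewrite subr_ge0 ler1n; apply/card_gt0P; exists (theta t). Qed.

(** [one_site_bound] is applied for each x', then the sums over x' are taken.
    The factor |X| - 1 from summing over a turns the coefficient c below into
    C_1 (1 + 2 e^||Delta|| N_X). *)
Lemma normL_Kop_le :
  normL I (Kop Delta le phi) <= const_C1 Delta * (1 + const_C2 theta Delta) * M.
Proof.
pose Kx x := gammaf theta Delta le x * (Sop le phi x + Top Delta le phi x).
rewrite /normL (@sum_Xstar _ _ _ theta I (fun x => `|Kx x|))//.
rewrite -(fsetD1K tI) sum_vfconfig_set; last by rewrite !inE eqxx.
pose s x' := if (1 < #|` I|)%N then ev phi x' else 0.
pose c := e * (1 + 2 * (e * N)) / (1 + e * N).
have eN0 : 0 <= e * N by rewrite mulr_ge0.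
have pN : 0 < 1 + e * N by lra.
have c0 : 0 <= c by rewrite divr_ge0 ?(ltW pN)// mulr_ge0//; lra.
apply: (@le_trans _ _ (\sum_(x' \in vfconfig (I `\ t))
   (const_C1 Delta * `|s x'| + c * \sum_(a | a != theta t) `|Gop Delta le phi x'.[t <- a]|))).
  rewrite !fsbig_finite; [|exact: finite_vfconfig..].
  rewrite big_seq [leRHS]big_seq; apply: ler_sum => x'.
  rewrite in_fset_set ?inE; last exact: finite_vfconfig.
  move=> [dx' _].
  apply: le_trans (one_site_bound (fun a => Gop Delta le phi x'.[t <- a]) (s x') (w1 x') (w_le x')).
  apply: ler_sum => a _.
  rewrite /Kx gammaf_min// Sop_min// Top_min// normrM -/(s x') -/t ger0_norm//.
  by rewrite divr_ge0 ?expR_ge0// sumr_ge0// => b _; exact: expR_ge0.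
rewrite [leLHS](_ : _ = const_C1 Delta * (\sum_(x' \in vfconfig (I `\ t)) `|s x'|) +
    c * \sum_(x' \in vfconfig (I `\ t))
          \sum_(a | a != theta t) `|Gop Delta le phi x'.[t <- a]|); last first.
  rewrite (mulr_fsumr (const_C1 Delta)) (mulr_fsumr c) fsbig_split//.
  exact: finite_vfconfig.
have sM : \sum_(x' \in vfconfig (I `\ t)) `|s x'| <= M.
  rewrite /s; case: (boolP (1 < #|` I|)%N) => I1; last first.
    by rewrite fsbig1// => x' _; rewrite normr0.
  have It0 : I `\ t != fset0.
    by rewrite -cardfs_gt0; move: I1; rewrite (cardfsD1 t) tI.
  by rewrite sum_ev_normL// phiM.
have GM : \sum_(x' \in vfconfig (I `\ t))
    \sum_(a | a != theta t) `|Gop Delta le phi x'.[t <- a]| <= N * (2 * M * E).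
  rewrite fsbig_finite; last exact: finite_vfconfig.
  rewrite exchange_big /= -(sum_neq_card (theta t)); apply: ler_sum => a _.
  rewrite -fsbig_finite; last exact: finite_vfconfig.
  exact: sum_Gop_le.
have C10 : 0 <= const_C1 Delta.
  by rewrite /const_C1 /const_N divr_ge0// ?(ltW pN).
apply: (le_trans (lerD (ler_wpM2l C10 sM) (ler_wpM2l c0 GM))).
rewrite le_eqVlt; apply/orP; left; apply/eqP.
rewrite /c /const_C1 /const_C2 /const_N; field.
by rewrite gt_eqF.
Qed.

End Bound.

(** On a one-point set the values of gamma are the probabilities of the
    non-vacuum spins. *)
Lemma normL_deltaf_le : normL (theta := theta) I (deltaf Delta le) <= 1.
Proof.
have [I1|I1] := eqVneq #|` I| 1%N; last first.
  rewrite /normL fsbig1// => u /= uI.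
  by rewrite /deltaf uI (negbTE I1) normr0.
have It0 : I `\ t = fset0.
  by apply/eqP; rewrite -cardfs_eq0; move: I1; rewrite (cardfsD1 t) tI add1n => -[->].
have -> : normL (theta := theta) I (deltaf Delta le) =
    \sum_(u \in Xstar theta I) `|gammaf theta Delta le (val u)|.
  by apply: eq_fsbigr => u; rewrite inE => /= uI; rewrite /deltaf uI I1.
rewrite (@sum_Xstar _ _ _ theta I (fun x => `|gammaf theta Delta le x|))//.
rewrite -(fsetD1K tI) sum_vfconfig_set; last by rewrite !inE eqxx.
have sub : vfconfig (I `\ t) = [set [fmap]]%classic.
  rewrite It0; apply/seteqP; split => [x [/fmap_nil->]//|_ ->].
  by split; [rewrite domf0|move=> s; rewrite fnd_fmap0].
have dom0 : domf ([fmap] : fconfig d X) = I `\ t by rewrite It0 domf0.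
rewrite sub fsbig_set1.
under eq_bigr do rewrite gammaf_min//.
set Z := \sum_b _.
have wpos b : 0 < expR (Delta (vac theta t [fmap]) b (theta t)) by exact: expR_gt0.
have Z0 : 0 < Z by rewrite /Z (bigD1 (theta t))//= ltr_wpDr ?sumr_ge0// => b _; exact: ltW.
under eq_bigr do rewrite ger0_norm ?divr_ge0 ?(ltW Z0) ?(ltW (wpos _))//.
rewrite -mulr_suml ler_pdivrMr// mul1r /Z [leRHS](bigD1 (theta t))//= lerDr.
exact: ltW.
Qed.

Section Linear.
Variables (phi psi : Lstar theta -> R) (M M' : R).
Hypothesis phiM : forall L, L != fset0 -> normL L phi <= M.
Hypothesis psiM : forall L, L != fset0 -> normL L psi <= M'.
Variable c : R.

Lemma Gterm_linear x J : Gterm Delta le (c *: phi + psi) x J =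
  c * Gterm Delta le phi x J + Gterm Delta le psi x J.
Proof.
rewrite /Gterm mulr_fsumr !fsbig_finite; [|exact: finite_Xstar..].
rewrite -big_split; apply: eq_bigr => y _ /=.
under eq_bigr do rewrite ev_linear.
rewrite ev_linear big_split/= -mulr_sumr; ring.
Qed.

(** [rsum] takes a junk value on families that are not absolutely summable, so
    additivity rests on the bounds on phi and psi. *)
Lemma Gop_linear x' a : vfconfig (I `\ t) x' ->
  Gop Delta le (c *: phi + psi) x'.[t <- a] =
  c * Gop Delta le phi x'.[t <- a] + Gop Delta le psi x'.[t <- a].
Proof.
move=> vx'; rewrite /Gop Gdom_min ?(proj1 vx')//.
have sphi := summable_Gterm phiM a vx'; have spsi := summable_Gterm psiM a vx'.
rewrite -rsumZ// -rsumD//; last exact: summableZ.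
by congr rsum; apply/funext => J; exact: Gterm_linear.
Qed.

Lemma Kop_linear (u : Lstar theta) : domf (val u) = I ->
  Kop Delta le (c *: phi + psi) u = c * Kop Delta le phi u + Kop Delta le psi u.
Proof.
move=> uI; have /starredE[_ uv] := valP u.
have [x' [a [vx' ue]]] : exists x' a, vfconfig (I `\ t) x' /\ val u = x'.[t <- a].
  exact: vfconfig_split.
have dx' := proj1 vx'.
rewrite /Kop ue !Sop_min// !Top_min// !Gop_linear//.
under eq_bigr do rewrite Gop_linear//.
rewrite mulrCA -mulrDr; congr (_ * _).
set S := \sum_(b | _) _; set S1 := \sum_(b | _) _; set S2 := \sum_(b | _) _.
have -> : S = c * S1 + S2.
  have alg (r A A' B B' : R) :
      r * (c * A + B - (c * A' + B')) = c * (r * (A - A')) + r * (B - B').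
    by ring.
  by rewrite /S /S1 /S2 mulr_sumr -big_split; apply: eq_bigr => b _; exact: alg.
have alg (r A B r' A' B' : R) :
    c * r + r' + (c * A + A' + (c * B + B')) = c * (r + (A + B)) + (r' + (A' + B')).
  by ring.
(* on a one-point set the term S vanishes, which is the identity for 0 + 0 *)
case: ifP => _; first by rewrite ev_linear alg.
by rewrite -[X in X + (_ + _)](addr0 0) -{1}(mulr0 c) alg.
Qed.

End Linear.
End FixedSet.

Lemma summable_Gterm_Bstar (phi : Bstar R theta) (x : Lstar theta) :
  summable (Gdom (val x)) (EFin \o Gterm Delta le phi (val x)).
Proof.
have /starredE[x0 xv] := valP x.
have [x' [a [vx' xe]]] := vfconfig_split x0 (conj erefl xv).
have xI := domf_min x0 a (proj1 vx').
rewrite /Gdom xe xI.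
have phiM L : L != fset0 -> normL L phi <= normB phi by exact: normL_le.
exact: (summable_Gterm x0 phiM a vx').
Qed.

Lemma Kop_Bstar :
  exists K : {linear Bstar R theta -> Bstar R theta},
    (forall phi : Bstar R theta, bstar_fun (K phi) = Kop Delta le phi) /\
    (forall phi : Bstar R theta,
       `|K phi| <= const_C1 Delta * (1 + const_C2 theta Delta) * `|phi|).
Proof.
have phiM (phi : Bstar R theta) L : L != fset0 -> normL L (val phi) <= normB phi.
  exact: normL_le.
have Kmem (phi : Bstar R theta) : (Kop Delta le phi : Lstar theta -> R) \in @Bstar_pred R d X theta.
  apply/Bstar_predP; eexists => L L0.
  exact: (normL_Kop_le L0 (phiM phi)).
pose K0 (phi : Bstar R theta) : Bstar R theta := exist _ (Kop Delta le phi) (Kmem phi).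
have [K KE] : exists K : {linear Bstar R theta -> Bstar R theta}, K =1 K0.
  apply: linear_function => c phi psi; apply/val_inj/funext => u.
  exact: (Kop_linear (Lstar_neq0 u) (phiM phi) (phiM psi) c erefl).
exists K; split => phi; rewrite KE//.
by apply: normB_le => L L0; exact: (normL_Kop_le L0 (phiM phi)).
Qed.

Lemma deltaf_Bstar : exists delta : Bstar R theta, bstar_fun delta = deltaf Delta le.
Proof.
have dmem : (deltaf Delta le : Lstar theta -> R) \in @Bstar_pred R d X theta.
  by apply/Bstar_predP; exists 1 => L L0; exact: normL_deltaf_le.
by exists (exist _ (deltaf Delta le) dmem).
Qed.

(** The constant times 1 bounds the norm of K 0, as 1 bounds the norm of 0. *)
Lemma const_ge0 : 0 <= const_C1 Delta * (1 + const_C2 theta Delta).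
Proof.
have [L L0] : exists L : {fset lattice d}, L != fset0.
  by exists [fset 0]%fset; apply/fset0Pn; exists 0; rewrite inE.
have := normL_Kop_le L0 (phi := 0 : Bstar R theta) (M := 1).
rewrite mulr1 => h; apply: le_trans (normL_ge0 L (Kop Delta le (0 : Bstar R theta))) (h _).
move=> J J0; apply: le_trans (normL_le (0 : Bstar R theta) J0) _.
by rewrite -Bstar_normE normr0.
Qed.
End Operator.

(** * The solution *)

Theorem theorem3 (R : realType) (d : nat) (X : finType)
    (theta : lattice d -> X) (le : rel (lattice d)) (Delta : energy_field R d X) :
  (1 <= d)%N -> (1 < #|X|)%N ->
  reflexive le -> antisymmetric le -> transitive le -> total le ->
  transition_energy_field Delta ->
  vacuum_increment_condition theta Delta ->
  tef_norm Delta \is a fin_num -> tef_D theta Delta \is a fin_num ->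
  const_C1 Delta * (1 + const_C2 theta Delta) < 1 ->
  (forall (phi : Bstar R theta) (x : Lstar theta),
     summable (Gdom (val x)) (EFin \o Gterm Delta le phi (val x))) /\
  exists (K : {linear Bstar R theta -> Bstar R theta}) (delta : Bstar R theta),
    [/\ continuous K,
        (forall phi : Bstar R theta, bstar_fun (K phi) = Kop Delta le phi),
        bstar_fun delta = deltaf Delta le &
        exists rho : Bstar R theta,
          [/\ rho = delta + K rho,
              (forall rho' : Bstar R theta, rho' = delta + K rho' -> rho' = rho) &
              exists L : {linear Bstar R theta -> Bstar R theta},
                [/\ continuous L,
                    cancel (fun phi => phi - K phi) L
                      /\ cancel L (fun phi => phi - K phi),
                    rho = L delta,
                    (forall e : R, 0 < e -> \forall N \near \oo,
                       forall phi : Bstar R theta,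
                       `|(phi + \sum_(1 <= n < N) iter n K phi) - L phi|
                         <= e * `|phi|) &
                    delta + \sum_(1 <= n < N) iter n K delta
                      @[N --> \oo] --> rho]]].
Proof.
move=> _ _ _ _ _ _ [cocycle _] _ norm_fin D_fin C_lt1.
split; first by move=> phi x; exact: summable_Gterm_Bstar.
have [K [KE Kle]] := Kop_Bstar le cocycle norm_fin D_fin.
have [delta deltaE] := deltaf_Bstar theta Delta le.
have [Kc [L [Lc KL LK Lunif Llim]]] := neumann (const_ge0 le cocycle norm_fin D_fin) C_lt1 Kle.
have shift N v : (1 <= N)%N ->
    v + \sum_(1 <= n < N) iter n K v = \sum_(0 <= n < N) iter n K v.
  by case: N => // N _; rewrite [RHS]big_ltn.
exists K, delta; split => //; exists (L delta); split.
- by rewrite -{2}(LK delta) subrK.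
- by move=> rho' rhoE; rewrite -(KL rho') {1}rhoE addrK.
- exists L; split => //.
  + move=> eps eps0; near=> N => phi; rewrite shift; last by near: N; exists 1.
    by move: phi; near: N; exact: Lunif.
  + apply: cvg_trans (Llim delta); apply: near_eq_cvg.
    by near=> N; rewrite shift//; near: N; exists 1.
Unshelve. all: by end_near. Qed.
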